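(* Let $m\ge 2$, $n\ge 1$ be integers and let $\Lambda:=(\mathcal{A}_1,\mathcal{A}_2,\ldots,\mathcal{A}_{m-1})\in \mathbb{T}_{m,n}\times \mathbb{T}_{m-1,n}\times\cdots\times\mathbb{T}_{2,n}$. Suppose that the leading tensor $\mathcal{A}_1$ is a ${\rm Z}^+$-tensor. Then for every $b\in\mathbb{R}^n$ the solution set $${\rm SOL}(\Lambda,b)=\{x\in\mathbb{R}^n : \mathcal{A}_1x^{m-1}+\mathcal{A}_2x^{m-2}+\cdots+\mathcal{A}_{m-2}x^2+\mathcal{A}_{m-1}x=b\}$$ is nonempty and compact.
   Context: $\mathbb{T}_{l,n}$ denotes the set of all $l$-th order $n$-dimensional square real tensors $\mathcal{A}=(a_{i_1i_2\cdots i_l})$, $i_1,\ldots,i_l\in\{1,\ldots,n\}$ (so $\mathbb{T}_{2,n}$ is the set of real $n\times n$ matrices). No symmetry is assumed. For $\mathcal{A}\in\mathbb{T}_{l,n}$ and $x\in\mathbb{R}^n$, $\mathcal{A}x^{l-1}\in\mathbb{R}^n$ is the vector with components $(\mathcal{A}x^{l-1})_i=\sum_{i_2,\ldots,i_l=1}^n a_{ii_2\cdots i_l}x_{i_2}\cdots x_{i_l}$, $i=1,\ldots,n$. In particular $\mathcal{A}_k\in\mathbb{T}_{m-k+1,n}$ and $\mathcal{A}_kx^{m-k}\in\mathbb{R}^n$. A tensor $\mathcal{A}\in\mathbb{T}_{m,n}$ is a ${\rm Z}^+$-tensor if there exists no pair $(x,t)\in(\mathbb{R}^n\setminus\{0\})\times\mathbb{R}_+$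 (with $\mathbb{R}_+=[0,\infty)$) such that $\mathcal{A}x^{m-1}+tx=0$. *)

(* Defs.v *)
From HB Require Import structures.
From mathcomp Require Import all_boot all_order all_algebra.
From mathcomp Require Import all_classical all_reals all_analysis.
Set Implicit Arguments.
Unset Strict Implicit.
Unset Printing Implicit Defensive.
Import Order.TTheory GRing.Theory Num.Theory.
Import numFieldNormedType.Exports.
Local Open Scope classical_set_scope.
Local Open Scope ring_scope.

Definition tensor (R : realType) (l n : nat) : Type :=
  {ffun l.-tuple 'I_n -> R}.

(* For [A] of order [l.+1], this is the vector $A x^l$. Vectors of $R^n$ are
   row vectors, for which the library proves the Heine-Borel theorem. *)
Definition tensor_app (R : realType) (l n : nat) (A : tensor R l.+1 n)
    (x : 'rV[R]_n) : 'rV[R]_n :=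
  \row_(i < n) \sum_(J : l.-tuple 'I_n)
    A [tuple of i :: J] * \prod_(k < l) x 0 (tnth J k).

Definition Zplus_tensor (R : realType) (l n : nat) (A : tensor R l.+1 n) :
    Prop :=
  ~ exists x : 'rV[R]_n, exists t : R,
      [/\ x != 0, 0 <= t & tensor_app A x + t *: x = 0].

(* The tuple $(A_1, \dots, A_{m-1})$ with $A_j$ of order $m - j + 1$;
   the index [k] is $j - 1$. *)
Definition tensor_tuple (R : realType) (m n : nat) : Type :=
  forall k : 'I_m.-1, tensor R (m - k.+1).+1 n.

Lemma leading_subproof (m : nat) (hm : (2 <= m)%N) : (0 < m.-1)%N.
Proof. by rewrite ltn_predRL. Qed.

Definition leading_tensor (R : realType) (m n : nat) (hm : (2 <= m)%N)
    (Lam : tensor_tuple R m n) : tensor R (m - 1).+1 n :=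
  Lam (Ordinal (leading_subproof hm)).

Definition SOL (R : realType) (m n : nat) (Lam : tensor_tuple R m n)
    (b : 'rV[R]_n) : set 'rV[R]_n :=
  [set x | \sum_(k < m.-1) tensor_app (Lam k) x = b].

(* Main.v *)
Require Import Defs.
From HB Require Import structures.
From mathcomp Require Import all_boot all_order all_algebra all_fingroup.
From mathcomp Require Import all_classical all_reals all_analysis.
From mathcomp Require Import zify ring lra.
Set Implicit Arguments.
Unset Strict Implicit.
Unset Printing Implicit Defensive.
Import Order.TTheory GRing.Theory Num.Theory.
Import numFieldNormedType.Exports.
Local Open Scope classical_set_scope.
Local Open Scope ring_scope.

(* Write F for the polynomial map on the left of the system. For large |x| the
   leading term dominates the others, so the Z+ condition and compactness of
   the unit sphere bound all x with F x - b + t x = 0 for some t >= 0. Taking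
   t = 0, the solution set is bounded, and it is closed. On the boundary of a
   larger sup-norm ball F x - b never points in the direction -x, so F - b
   vanishes inside the ball, by applying the Poincare-Miranda theorem to
   x |-> |F x - b| x + r (F x - b). Poincare-Miranda follows by compactness
   from its discrete form on a grid: labels a_i : vertices -> F_2 that are 0
   on the face v_i = 0 and 1 on the opposite face all change inside some cell.
   That holds because the sum over the cells of the cup product
   da_0 u ... u da_n is unchanged (Stokes) when the a_i are replaced one at a
   time by the indicators of v_i > 0, for which it equals 1. *)

(** * The discrete Poincare-Miranda theorem *)

Lemma addrr_F2 (x : 'F_2) : x + x = 0.
Proof. exact/addrr_pchar2/pchar_Fp. Qed.

Lemma eq_F2 (x y : 'F_2) : x + y = 0 -> x = y.
Proof. by move=> h; rewrite -[x]addr0 -(addrr_F2 y) addrA h add0r. Qed.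

(** Multiplication by the transposition pairs even with odd permutations, and equal terms cancel
    modulo 2. *)
Lemma sum_perm_tperm_F2 (T : finType) (x y : T) (F : {perm T} -> 'F_2) :
  x != y -> (forall s, F (s * tperm x y)%g = F s) -> \sum_s F s = 0.
Proof.
move=> xy FE; rewrite (bigID (fun s : {perm T} => odd_perm s)) /=.
rewrite [X in _ + X](reindex_inj (mulIg (tperm x y))) /=.
rewrite [X in _ + X](eq_big (fun s : {perm T} => odd_perm s) F) ?addrr_F2 //.
by move=> s; rewrite odd_permM odd_tperm xy addbT negbK.
Qed.

Lemma prodD1 (R : comPzRingType) (I : finType) (j : I) (F : I -> R) :
  \prod_i F i = F j * \prod_(i | i != j) F i.
Proof. by rewrite (bigD1 j). Qed.

Section Kuhn.
Variables (n N : nat).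
Notation grid := {ffun 'I_n.+1 -> nat}.
Notation cell := {ffun 'I_n.+1 -> 'I_N.+1}.

(* The vertices [vtx z s 0, ..., vtx z s n.+1] form the Kuhn simplex of the unit
   cell at [z] in which the direction [d] is the [s d]-th one to be followed. *)
Definition vtx (z : cell) (s : 'S_n.+1) (j : nat) : grid :=
  [ffun d => (z d + (s d < j))%N].

(** Exchanging two consecutive steps of the path moves only the vertex reached between them. *)
Lemma vtx_tperm z (s : 'S_n.+1) (p q : 'I_n.+1) (j : nat) :
  q = p.+1 :> nat -> j != q ->
  vtx z (s * tperm p q)%g j = vtx z s j.
Proof.
move=> qp jq; apply/ffunP => d; rewrite !ffunE permM; congr (_ + nat_of_bool _)%N.
case: tpermP => [->|->|//]; lia.
Qed.

Definition proper (a : 'I_n.+1 -> grid -> 'F_2) : Prop :=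
  forall i (v : grid), (v i = 0%N -> a i v = 0) /\ (v i = N.+1 -> a i v = 1).

Definition cup (a : 'I_n.+1 -> grid -> 'F_2) : 'F_2 :=
  \sum_(z : cell) \sum_s \prod_i (a i (vtx z s i) + a i (vtx z s i.+1)).

Section Replace.
Variables (a : 'I_n.+1 -> grid -> 'F_2) (D : grid -> 'F_2) (k : 'I_n.+1).
Hypothesis a_proper : proper a.
Hypothesis D0 : forall v : grid, v k = 0%N \/ v k = N.+1 -> D v = 0.

(* [factor w i] is the [i]-th factor of da_0 u ... u D u ... u da_n evaluated on
   the simplex [w 0, ..., w n], the 0-cochain [D] standing in position [k]. *)
Definition factor (w : nat -> grid) (i : 'I_n.+1) : 'F_2 :=
  if i == k then D (w k)
  else if (i < k)%N then a i (w i) + a i (w i.+1)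
  else a i (w i.-1) + a i (w i).

(* The factors from the [p]-th on are shifted by one vertex, so that [p] runs
   from the facet opposite to vertex 0 to the one opposite to the last one. *)
Definition gfactor z s p (i : 'I_n.+1) : 'F_2 :=
  factor (fun j => vtx z s (j + (p <= i))%N) i.

Definition gapsum p := \sum_(z : cell) \sum_s \prod_i gfactor z s p i.

(* The only factor that changes is the [p]-th; the sum of its two values does
   not involve the vertex between its two edges, so that the simplices exchanged by
   a transposition cancel in pairs. *)
Lemma gapsumS (p : 'I_n.+1) : p != k -> gapsum p = gapsum p.+1.
Proof.
move=> pk; apply: eq_F2; rewrite -big_split big1 // => z _ /=.
rewrite -big_split /=.
(* The two edges share the vertex of index [y], which is [p.+1] for [p < k] and [p] for [p > k]; the
   steps [x] and [y] lead to it and away from it. *)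
have pq : exists x y : 'I_n.+1, [/\ y = x.+1 :> nat &
   if (p < k)%N then x = p else y = p].
  case: ltnP => h.
    have h1 : (p.+1 < n.+1)%N by have := ltn_ord k; lia.
    by exists p, (Ordinal h1).
  have h1 : (p.-1 < n.+1)%N by have := ltn_ord p; lia.
  exists (Ordinal h1), p; split => //=.
  move/eqP: pk => pk; have : (p : nat) <> k by move=> /val_inj.
  lia.
have [x [y [yx xyp]]] := pq.
apply: (@sum_perm_tperm_F2 _ x y) => [|s].
  by apply/eqP => /(congr1 val) /=; lia.
have pkn : (p : nat) <> k by move=> /val_inj /eqP; rewrite (negbTE pk).
rewrite !(prodD1 p).
have same i : i != p -> gfactor z s p.+1 i = gfactor z s p i.
  move=> ip; rewrite /gfactor; suff -> : (p < i)%N = (p <= i)%N by [].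
  by have : (i : nat) <> p by [move=> /val_inj /eqP; rewrite (negbTE ip)]; lia.
have same' i : i != p ->
    gfactor z (s * tperm x y)%g p.+1 i = gfactor z s p i /\
    gfactor z (s * tperm x y)%g p i = gfactor z s p i.
  move=> ip; have ipn : (i : nat) <> p.
    by move=> /val_inj /eqP; rewrite (negbTE ip).
  have -> : gfactor z (s * tperm x y)%g p.+1 i = gfactor z (s * tperm x y)%g p i.
    by rewrite /gfactor; suff -> : (p < i)%N = (p <= i)%N by []; lia.
  suff -> : gfactor z (s * tperm x y)%g p i = gfactor z s p i by [].
  rewrite /gfactor /factor.
  case: eqP => [ik|/eqP ik].
    rewrite ik in ipn *; rewrite vtx_tperm //.
    by move: xyp; case: ltnP => h e; subst; apply/eqP; lia.
  have ikn : (i : nat) <> k by move=> /val_inj /eqP; rewrite (negbTE ik).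
  case: (ltnP i k) => hik; rewrite !vtx_tperm //;
    by move: xyp; case: ltnP => h e; subst; apply/eqP; lia.
rewrite (eq_bigr (gfactor z s p)) => [|i /same' []//].
rewrite [X in _ + _ * X](eq_bigr (gfactor z s p)) => [|i /same' []//].
rewrite [X in _ = _ + _ * X](eq_bigr (gfactor z s p)) => [|i /same //].
rewrite -!mulrDl; congr (_ * _).
rewrite /gfactor /factor (negbTE pk) leqnn ltnn !addn0 !addn1.
have tel (u v w : 'F_2) : u + v + (w + u) = w + v.
  by rewrite addrACA [u + w]addrC -addrA [u + _]addrC -addrA addrr_F2 addr0.
move: xyp; case: ltnP => h e; subst.
  by rewrite !tel -!yx !(@vtx_tperm _ s p y) //; apply/eqP; lia.
have -> : (p.-1.+1 = p) by lia.
by rewrite !tel !(@vtx_tperm _ s x p) //; apply/eqP; lia.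
Qed.

(** On a boundary face orthogonal to [d], the label [a d] is constant by properness, so its
    difference along an edge vanishes; if [d = k], then [D] itself is zero there. *)
Lemma gfactor_face z (s : 'S_n.+1) p (d : 'I_n.+1) c : (c = 0%N \/ c = N.+1) ->
  (forall j, (j < n.+1)%N -> vtx z s (j + (p <= d))%N d = c) ->
  gfactor z s p d = 0.
Proof.
move=> hc face; rewrite /gfactor /factor.
case: eqP => [dk|/eqP dk].
  by apply: D0; rewrite -dk face ?ltn_ord.
have av (v w : grid) : v d = c -> w d = c -> a d v + a d w = 0.
  have [a0 aN] := (a_proper d v); have [b0 bN] := (a_proper d w).
  case: hc => -> v0 w0; first by rewrite a0 // b0 // addr0.
  by rewrite aN // bN // addrr_F2.
have dkn : (d : nat) <> k by move=> /val_inj /eqP; rewrite (negbTE dk).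
have := ltn_ord d; have := ltn_ord k.
by case: (ltnP d k) => h hk hd; apply: av; apply: face; lia.
Qed.

Definition rot_cell (u : cell * 'S_n.+1) : cell * 'S_n.+1 :=
  ([ffun d => if u.2 d == ord0 then ordS (u.1 d) else u.1 d],
   (u.2 * perm (@ord_pred_inj n.+1))%g).

Lemma rot_cell_inj : injective rot_cell.
Proof.
move=> [z s] [z' s'] [/ffunP zz' /mulIg ss']; subst s'; congr (_, _).
apply/ffunP => d; have := zz' d; rewrite !ffunE /=.
by case: eqP => // _ /ordS_inj.
Qed.

(* [rot_cell] sends a simplex to the one sharing its facet opposite to vertex 0;
   where it wraps around the grid, both facets lie on boundary faces, on which
   the products vanish. *)
Lemma gapsum_ends : gapsum 0 = gapsum n.+1.
Proof.
rewrite /gapsum !pair_big /= [RHS](reindex_inj rot_cell_inj) /=.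
apply: eq_bigr => -[z s] _ /=.
set z' := [ffun d => _]; set s' := (s * _)%g.
have [d0 sd0] : exists d, s d = ord0 by exists ((s^-1)%g ord0); rewrite permKV.
have s'E d : s' d = ord_pred (s d) by rewrite permM permE.
have [zN|zN] := eqVneq (z d0 : nat) N.
  rewrite !(prodD1 d0).
  have -> : gfactor z s 0 d0 = 0.
    apply: (@gfactor_face _ _ _ _ N.+1); first by right.
    by move=> j _; rewrite ffunE sd0 zN /= addn1 addn1.
  have -> : gfactor z' s' n.+1 d0 = 0; last by rewrite !mul0r.
  apply: (@gfactor_face _ _ _ _ 0%N); first by left.
  move=> j jn; rewrite ffunE /z' ffunE s'E sd0 eqxx /= zN modnn.
  have := ltn_ord d0; rewrite ltnNge => /negbTE ->.
  by rewrite add0n addn0 /= modn_small //; lia.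
have zd0 := ltn_ord (z d0).
have same j : (j <= n)%N -> vtx z s j.+1 = vtx z' s' j.
  move=> jn; apply/ffunP => d; rewrite !ffunE s'E /=.
  have sd := ltn_ord (s d).
  case: (eqVneq (s d) ord0) => [e|ne].
    have -> : d = d0 by apply: (@perm_inj _ s); rewrite e.
    by rewrite sd0 /= !modn_small; lia.
  have ne' : (s d : nat) <> 0%N.
    by move=> e; case/eqP: ne; apply/val_inj.
  have -> : ((s d + n.+1).-1 %% n.+1 = (s d).-1)%N.
    rewrite (_ : (s d + n.+1).-1 = (s d).-1 + n.+1)%N; last by lia.
    by rewrite modnDr modn_small; lia.
  lia.
apply: eq_bigr => i _; rewrite /gfactor /factor leq0n.
have hi := ltn_ord i; have hk := ltn_ord k.
have -> : (n < i)%N = false by lia.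
rewrite /= !addn0 !addn1.
case: eqP => [//|/eqP ik]; first by rewrite same //; lia.
have ikn : (i : nat) <> k by move=> /val_inj /eqP; rewrite (negbTE ik).
case: (ltnP i k) => h; first by rewrite !same //; lia.
by rewrite !same //; lia.
Qed.

(** Since [gapsumS] excludes [p = k], the equality is reached the other way around the cycle: from
    [k] down to 0, across by [gapsum_ends], then from [n.+1] down to [k.+1]. *)
Lemma gapsumSk : gapsum k = gapsum k.+1.
Proof.
have low p : (p <= k)%N -> gapsum p = gapsum 0.
  elim: p => // p IH pk; rewrite -IH; last by lia.
  have pn : (p < n.+1)%N by have := ltn_ord k; lia.
  rewrite -(@gapsumS (Ordinal pn)) //; apply/eqP => /(congr1 val) /=; lia.
have high p : (p + k <= n)%N -> gapsum (k.+1 + p) = gapsum k.+1.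
  elim: p => [|p IH] pk; first by rewrite addn0.
  rewrite -IH; last by lia.
  have pn : (k.+1 + p < n.+1)%N by lia.
  rewrite addnS -(@gapsumS (Ordinal pn)) //; apply/eqP => /(congr1 val) /=; lia.
have kn := ltn_ord k.
rewrite (low k) // gapsum_ends -(high (n - k)%N); last by lia.
by congr gapsum; lia.
Qed.

(** Splitting the [k]-th factor into its two values of [D] gives [gapsum k.+1] and [gapsum k], which
    are equal and so cancel. *)
Lemma cup_defect :
  \sum_(z : cell) \sum_s \prod_i
    (if i == k then D (vtx z s k) + D (vtx z s k.+1)
     else a i (vtx z s i) + a i (vtx z s i.+1)) = 0.
Proof.
transitivity (gapsum k + gapsum k.+1); last by rewrite -gapsumSk addrr_F2.
rewrite -big_split /=; apply: eq_bigr => z _.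
rewrite -big_split /=; apply: eq_bigr => s _.
rewrite !(prodD1 k) eqxx.
have gE (p : nat) (i : 'I_n.+1) : i != k -> p = k \/ p = k.+1 -> gfactor z s p i =
    a i (vtx z s i) + a i (vtx z s i.+1).
  move=> ik hp; rewrite /gfactor /factor (negbTE ik).
  have ikn : (i : nat) <> k by move=> /val_inj /eqP; rewrite (negbTE ik).
  case: (ltnP i k) => h.
    have -> : (p <= i)%N = false by lia.
    by rewrite !addn0.
  have -> : (p <= i)%N by lia.
  by rewrite !addn1 prednK; last by lia.
rewrite [in RHS](eq_bigr _ (fun i ik => gE k i ik (or_introl erefl))).
rewrite [X in _ = _ + _ * X]
  (eq_bigr _ (fun i ik => gE k.+1 i ik (or_intror erefl))).
rewrite -mulrDl /gfactor /factor eqxx leqnn ltnn addn0 addn1 addrC.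
rewrite [X in X * _ = _]addrC [X in _ = X * _]addrC.
by congr (_ * _); apply: eq_bigr => i /negbTE ->.
Qed.
End Replace.

(** The product is additive in its [k]-th label, and [a k + a' k] vanishes on both faces orthogonal
    to [k], so [cup_defect] applies to it. *)
Lemma cup_replace (a a' : 'I_n.+1 -> grid -> 'F_2) k :
  proper a -> proper a' -> (forall i, i != k -> a i = a' i) -> cup a = cup a'.
Proof.
move=> pa pa' aa'; apply: eq_F2.
apply: eq_trans (@cup_defect a (fun v => a k v + a' k v) k pa _); last first.
  move=> v [h|h]; have [a0 aN] := pa k v; have [b0 bN] := pa' k v.
    by rewrite a0 // b0 // addr0.
  by rewrite aN // bN // addrr_F2.
rewrite -big_split; apply: eq_bigr => z _.
rewrite -big_split; apply: eq_bigr => s _ /=.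
rewrite !(prodD1 k) eqxx.
rewrite [X in _ + _ * X](eq_bigr (fun i => a i (vtx z s i) + a i (vtx z s i.+1)));
  last by move=> i ik; rewrite aa'.
rewrite [X in _ = _ * X](eq_bigr (fun i => a i (vtx z s i) + a i (vtx z s i.+1)));
  last by move=> i /negbTE ->.
by rewrite -mulrDl addrACA.
Qed.

Definition coord_sign (i : 'I_n.+1) (v : grid) : 'F_2 := (0 < v i)%N%:R.

Lemma coord_sign_proper : proper coord_sign.
Proof. by move=> i v; split; rewrite /coord_sign => ->. Qed.

(** The [i]-th factor is nonzero exactly when [z i = 0] and [s i = i], so a single simplex
    contributes. *)
Lemma cup_coord_sign : cup coord_sign = 1.
Proof.
rewrite /cup pair_big /= (bigD1 ([ffun _ => ord0], 1%g)) //= [X in _ + X]big1.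
  rewrite addr0 big1 // => i _.
  by rewrite /coord_sign !ffunE perm1 /= ltnn ltnSn add0r.
move=> [z s] /= zs; apply/eqP; rewrite prodf_seq_eq0.
apply: contraR zs => /hasPn nz.
have {}nz i : z i = ord0 /\ s i = i.
  have := nz i (mem_index_enum _); rewrite /= /coord_sign !ffunE => h.
  suff : (z i == 0 :> nat)%N && (s i == i :> nat)%N.
    by move=> /andP[/eqP zi /eqP si]; split; apply/val_inj.
  move: h; rewrite !addn_gt0 ltnS.
  case: (z i : nat) => [|x] //=.
  by case: (ltngtP (s i) i).
apply/eqP; congr (_, _).
  by apply/ffunP => d; rewrite ffunE; have [] := nz d.
by apply/permP => d; rewrite perm1; have [] := nz d.
Qed.

Lemma cup_proper a : proper a -> cup a = 1.
Proof.
move=> pa; rewrite -cup_coord_sign.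
pose h p (i : 'I_n.+1) := if (i < p)%N then coord_sign i else a i.
have hp p : proper (h p).
  by move=> i v; rewrite /h; case: ifP => _; [exact: coord_sign_proper|exact: pa].
have e p : (p <= n.+1)%N -> cup (h p) = cup a.
  elim: p => [//|p IH pn]; rewrite -IH; last by lia.
  apply: (@cup_replace _ _ (Ordinal pn)) => // i /eqP ip.
  rewrite /h; suff -> : (i < p.+1)%N = (i < p)%N by [].
  have : (i : nat) <> p by move=> ip'; apply: ip; apply/val_inj.
  lia.
rewrite -(e n.+1) //; apply: eq_bigr => z _; apply: eq_bigr => s _.
by apply: eq_bigr => i _; rewrite /h ltn_ord.
Qed.

(** Without such a simplex every product has a zero factor and [cup] is 0, against [cup_proper]. *)
Lemma discrete_miranda (a : 'I_n.+1 -> grid -> bool) :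
  (forall i (v : grid), v i = 0%N -> a i v = false) ->
  (forall i (v : grid), v i = N.+1 -> a i v = true) ->
  exists (z : cell) (s : 'S_n.+1), forall i,
    a i (vtx z s i) != a i (vtx z s i.+1).
Proof.
move=> a0 a1; pose b i v : 'F_2 := (a i v)%:R.
have pb : proper b by move=> i v; split => h; rewrite /b ?(a0 _ _ h) ?(a1 _ _ h).
case: (boolP [exists z : cell, [exists s : 'S_n.+1, [forall i,
    a i (vtx z s i) != a i (vtx z s i.+1)]]]).
  by move=> /existsP[z /existsP[s /forallP h]]; exists z, s.
move=> /existsPn none; have := cup_proper pb.
rewrite /cup big1 => [/eqP|z _]; first by rewrite eq_sym oner_eq0.
rewrite big1 // => s _; have /existsPn/(_ s)/forallPn[i] := none z.
by rewrite negbK => /eqP ai; rewrite (prodD1 i) /b ai addrr_F2 mul0r.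
Qed.
End Kuhn.

(** * Zeros of continuous maps on a cube *)

Lemma coord_le_norm (R : realType) n (x : 'rV[R]_n) i : `|x 0 i| <= `|x|.
Proof.
by rewrite [leRHS]/Num.norm /= mx_normrE; apply/bigmax_geP; right; exists (0, i).
Qed.

Lemma norm_rV_le (R : realType) n (x : 'rV[R]_n) (c : R) :
  0 <= c -> (forall i, `|x 0 i| <= c) -> `|x| <= c.
Proof.
move=> c0 xc; rewrite [leLHS]/Num.norm /= mx_normrE; apply/bigmax_leP; split=> //.
by move=> [i j] _ /=; rewrite ord1.
Qed.

Lemma continuous_add (R : realType) (V : pseudoMetricNormedZmodType R)
    (T : topologicalType) (f g : T -> V) :
  continuous f -> continuous g -> continuous (fun x => f x + g x).
Proof. by move=> cf cg x; apply: cvgD; [exact: cf|exact: cg]. Qed.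

Lemma continuous_mul (R : realType) (T : topologicalType) (f g : T -> R) :
  continuous f -> continuous g -> continuous (fun x => f x * g x).
Proof. by move=> cf cg x; apply: cvgM; [exact: cf|exact: cg]. Qed.

Lemma continuous_row (R : realType) (T : topologicalType) n
    (f : 'I_n -> T -> R) :
  (forall i, continuous (f i)) -> continuous (fun x => \row_i f i x).
Proof.
move=> cf x; apply/cvgrPdist_le => e e0.
have near_f : \forall y \near x, forall i, `|f i x - f i y| <= e.
  by apply: filter_forall => i; apply: (cvgrPdist_le _ _).1 => //; exact: cf.
near=> y; apply: norm_rV_le => [|i]; first exact: ltW.
by rewrite !mxE; move: i; near: y.
Unshelve. all: by end_near. Qed.

Lemma poincare_miranda (R : realType) n (f : 'I_n.+1 -> 'rV[R]_n.+1 -> R)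
    (r : R) : 0 < r -> (forall i, continuous (f i)) ->
  (forall i (x : 'rV[R]_n.+1), `|x| <= r -> x 0 i = - r -> f i x <= 0) ->
  (forall i (x : 'rV[R]_n.+1), `|x| <= r -> x 0 i = r -> 0 <= f i x) ->
  exists2 x, `|x| <= r & forall i, f i x = 0.
Proof.
move=> r0 cf flo fhi; apply: contrapT => nozero.
pose K := [set x : 'rV[R]_n.+1 | `|x| <= r].
have cK : compact K.
  apply: bounded_closed_compact.
    exists r; split => [|M rM x /= xr]; first exact: num_real.
    exact: le_trans xr (ltW rM).
  have -> : K = Num.norm @^-1` [set y | y <= r] by [].
  apply: preimage_closed; last exact: closed_le.
  by move=> x _; exact: norm_continuous.
pose mesh (N : nat) := 2 * r / N.+1%:R.
pose P (N : nat) (x : 'rV[R]_n.+1) := exists i,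
  (forall y, `|x - y| <= mesh N -> 0 < f i y) \/
  (forall y, `|x - y| <= mesh N -> f i y < 0).
(* In the absence of a common zero, some [f i] keeps a strict sign near each point; compactness
   makes one [N] serve the whole cube. *)
have [N _ PN] : \forall N \near \oo, K `<=` P N.
  apply: (compact_near_coveringP K).1 => // x Kx.
  have [i fi] : exists i, f i x != 0.
    apply: contrapT => h; apply: nozero; exists x => // i.
    by apply/eqP; apply: contrapT => /negP fi; apply: h; exists i.
  have [e e0 he] : exists2 e : R, 0 < e &
      (forall y, `|x - y| < e -> 0 < f i y) \/
      (forall y, `|x - y| < e -> f i y < 0).
    case: (ltgtP (f i x) 0) fi => // fi _.
      have [e e0 he] := (nbhs_ballP _ _).1 (cvgr_lt _ (cf i x) _ fi).
      by exists e => //; right => y xy; apply: he; rewrite -ball_normE.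
    have [e e0 he] := (nbhs_ballP _ _).1 (cvgr_gt _ (cf i x) _ fi).
    by exists e => //; left => y xy; apply: he; rewrite -ball_normE.
  have e2 : 0 < e / 2 by lra.
  exists (ball x (e / 2), [set N | mesh N < e / 2]) => [|[x' N]/=].
    split; first exact: nbhsx_ballx.
    have [N0 hN0] : exists N0 : nat, 2 * r / (e / 2) < N0%:R.
      by exists (Num.trunc (2 * r / (e / 2))).+1; rewrite truncnS_gt.
    exists N0 => // N /= NN0; rewrite /mesh ltr_pdivrMr // [ltRHS]mulrC -ltr_pdivrMr //.
    by apply: (lt_le_trans hN0); rewrite ler_nat; lia.
  rewrite -ball_normE /= => -[xx' hN]; exists i.
  have dist y : `|x' - y| <= mesh N -> `|x - y| < e.
    move=> h; have -> : x - y = (x - x') + (x' - y) by rewrite addrA subrK.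
    by have := ler_normD (x - x') (x' - y); lra.
  by case: he => he; [left|right] => y /dist; exact: he.
have {}PN := PN N (leqnn N).
have N0 : 0 < N.+1%:R :> R by [].
pose pt (v : {ffun 'I_n.+1 -> nat}) : 'rV[R]_n.+1 :=
  \row_i (- r + mesh N * (v i)%:R).
have meshN : mesh N * N.+1%:R = 2 * r by rewrite /mesh divfK ?gt_eqF.
have mesh0 : 0 < mesh N by rewrite divr_gt0 ?mulr_gt0.
have ptK (v : {ffun 'I_n.+1 -> nat}) : (forall i, (v i <= N.+1)%N) -> `|pt v| <= r.
  move=> vN; apply: norm_rV_le => [|i]; first exact: ltW.
  rewrite mxE ler_norml; have : (v i)%:R <= N.+1%:R :> R by rewrite ler_nat.
  rewrite -(ler_pM2l mesh0) meshN.
  have : 0 <= mesh N * (v i)%:R by rewrite mulr_ge0 // ltW.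
  lra.
(* The label records the sign of [f i], but is forced on the two faces: [f i] may vanish on the
   upper one, and [discrete_miranda] also quantifies over vertices outside the cube. *)
pose a i (v : {ffun 'I_n.+1 -> nat}) :=
  (v i != 0%N) && ((v i == N.+1) || (0 < f i (pt v))).
have [z [s zs]] : exists (z : {ffun 'I_n.+1 -> 'I_N.+1}) (s : 'S_n.+1),
    forall i, a i (vtx z s i) != a i (vtx z s i.+1).
  apply: discrete_miranda => i v vi; rewrite /a vi //.
  by rewrite eqxx.
have vN j i : (vtx z s j i <= N.+1)%N.
  by rewrite ffunE; have := ltn_ord (z i); lia.
pose x := pt (vtx z s 0).
have [i hi] := PN x (ptK _ (vN 0%N)).
(* Each coordinate advances at most once along the simplex, so all vertices are within one mesh of
   the first in sup norm. Hence [f i] has one strict sign on them and the [i]-th label cannot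
   change. *)
have xnear j : `|x - pt (vtx z s j)| <= mesh N.
  apply: norm_rV_le => [|k]; first exact: ltW.
  rewrite !mxE !ffunE ltn0 addn0 natrD.
  have -> : - r + mesh N * (z k)%:R - (- r + mesh N * ((z k)%:R + (s k < j)%N%:R))
    = - (mesh N * (s k < j)%N%:R) by ring.
  rewrite normrN ger0_norm; last exact: mulr_ge0 (ltW mesh0) (ler0n _ _).
  by case: (s k < j)%N; rewrite ?mulr1 ?mulr0 // ltW.
have /eqP := zs i; apply.
case: hi => hi.
  suff h j : a i (vtx z s j) by rewrite !h.
  rewrite /a (hi _ (xnear j)) orbT andbT; apply/eqP => v0.
  have : f i (pt (vtx z s j)) <= 0.
    by apply: flo; [exact: ptK|rewrite mxE v0 mulr0 addr0].
  by rewrite leNgt hi.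
suff h j : a i (vtx z s j) = false by rewrite !h.
have fn := hi _ (xnear j); rewrite /a [0 < _]ltNge (ltW fn) orbF.
case: (vtx z s j i =P N.+1) => [vE|_]; last by rewrite /= andbF.
have : 0 <= f i (pt (vtx z s j)).
  by apply: fhi; [exact: ptK|rewrite mxE vE meshN; ring].
by rewrite leNgt fn.
Qed.

Lemma zero_of_outward (R : realType) n (g : 'rV[R]_n.+1 -> 'rV[R]_n.+1)
    (r : R) : 0 < r -> continuous g ->
  (forall (x : 'rV[R]_n.+1) (t : R), `|x| = r -> 0 < t -> g x + t *: x != 0) ->
  exists x, g x = 0.
Proof.
move=> r0 cg out.
have cgi i : continuous (fun x => g x 0 i).
  move=> x; apply: (@continuous_comp _ _ _ g (fun y : 'rV[R]_n.+1 => y 0 i)).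
    exact: cg.
  exact: coord_continuous.
(* On the faces [x 0 i = r] and [x 0 i = - r] this is [r] times [g x 0 i] plus or minus the norm of
   [g x], whose sign is known because the norm dominates each coordinate. *)
pose f i (x : 'rV[R]_n.+1) := x 0 i * `|g x| + r * g x 0 i.
have [] := @poincare_miranda R n f r r0.
- move=> i; apply: continuous_add; apply: continuous_mul.
  + exact: coord_continuous.
  + by move=> x; apply: continuous_comp; [exact: cg|exact: norm_continuous].
  + exact: cst_continuous.
  + exact: cgi.
- move=> i x _ xi; rewrite /f xi mulNr addrC -mulrBr.
  have := coord_le_norm (g x) i; have := ler_norm (g x 0 i) => h1 h2.
  by rewrite pmulr_rle0 //; lra.
- move=> i x _ xi; rewrite /f xi -mulrDr pmulr_rge0 //.
  have := coord_le_norm (g x) i; have := ler_norm (- g x 0 i).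
  by rewrite normrN; lra.
move=> x xr fx.
have gx : `|g x| *: x + r *: g x = 0.
  by apply/rowP => i; rewrite !mxE mulrC; exact: fx.
have [g0|g0] := eqVneq (g x) 0; first by exists x.
have ng : 0 < `|g x| by rewrite normr_gt0.
(* Taking norms here forces [x] onto the sphere of radius [r], where [out] forbids this relation. *)
have gE : g x + (`|g x| / r) *: x = 0.
  apply: (scalerI (lt0r_neq0 r0)).
  by rewrite scaler0 scalerDr scalerA mulrC divfK ?gt_eqF // addrC.
have xr' : `|x| = r.
  have : `|g x| * `|x| = r * `|g x|.
    have := congr1 Num.norm (addr0_eq gx).
    by rewrite normrN !normrZ normr_id (gtr0_norm r0).
  by rewrite mulrC => /mulIf; apply; rewrite gt_eqF.
have := out x _ xr' (divr_gt0 ng r0); by rewrite gE eqxx.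
Qed.

(** * Tensor systems *)

Lemma tensor_app_continuous (R : realType) l n (A : tensor R l.+1 n) :
  continuous (tensor_app A).
Proof.
apply: continuous_row => i; apply: continuous_big => [|J _].
  exact: (@add_continuous R^o).
apply: continuous_mul; first exact: cst_continuous.
apply: continuous_big => [|k _]; first exact: mul_continuous.
exact: coord_continuous.
Qed.

Lemma tensor_app_scale (R : realType) l n (A : tensor R l.+1 n) c x :
  tensor_app A (c *: x) = c ^+ l *: tensor_app A x.
Proof.
apply/rowP => i; rewrite !mxE mulr_sumr; apply: eq_bigr => J _.
rewrite mulrCA; congr (_ * _).
rewrite -[in c ^+ l](card_ord l) -prodr_const -big_split /=.
by apply: eq_bigr => k _; rewrite mxE.
Qed.

Lemma tensor_app_bound (R : realType) l n (A : tensor R l.+1 n) :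
  exists2 C, 0 <= C & forall x, `|tensor_app A x| <= C * `|x| ^+ l.
Proof.
exists (\sum_i \sum_(J : l.-tuple 'I_n) `|A [tuple of i :: J]|) => [|x].
  by do 2!apply: sumr_ge0 => ? _.
apply: norm_rV_le => [|i].
  by apply: mulr_ge0; [do 2!apply: sumr_ge0 => ? _|exact: exprn_ge0].
rewrite mxE (bigD1 i) //= mulrDl; apply: ler_wpDr.
  by apply: mulr_ge0; [do 2!apply: sumr_ge0 => ? _|exact: exprn_ge0].
rewrite mulr_suml; apply: le_trans (ler_norm_sum _ _ _) _.
apply: ler_sum => J _; rewrite normrM ler_wpM2l // normr_prod.
rewrite -[in X in _ <= X](card_ord l) -prodr_const.
by apply: ler_prod => k _; rewrite normr_ge0 coord_le_norm.
Qed.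

Lemma compact_sphere (R : realType) n : compact [set x : 'rV[R]_n | `|x| = 1].
Proof.
apply: bounded_closed_compact.
  by exists 1; split => [|M M1 x /= ->]; [exact: num_real|exact: ltW].
have -> : [set x : 'rV[R]_n | `|x| = 1] = Num.norm @^-1` [set y | y = 1] by [].
apply: preimage_closed; last exact: closed_eq.
by move=> x _; exact: norm_continuous.
Qed.

Lemma Zplus_lower_bound (R : realType) l n (A : tensor R l.+1 n.+1) :
  Zplus_tensor A -> exists2 d, 0 < d &
  forall (y : 'rV[R]_n.+1) t, `|y| = 1 -> 0 <= t ->
    d <= `|tensor_app A y + t *: y|.
Proof.
move=> ZA; have [C C0 hC] := tensor_app_bound A.
(* For [t > C + 1] the norm exceeds [t - C - 0 > 1] on the unit sphere or equals it at worst, so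
   only this compact range of [t] requires a minimum. *)
pose K := [set x : 'rV[R]_n.+1 | `|x| = 1] `*` `[0, C + 1]%classic.
have cK : compact K.
  by apply: compact_setX; [exact: compact_sphere|exact: segment_compact].
pose phi (u : 'rV[R]_n.+1 * R) := `|tensor_app A u.1 + u.2 *: u.1|.
have cphi : continuous phi.
  move=> u; apply: cvg_norm; apply: cvgD.
    apply: (@continuous_comp _ _ _ fst (tensor_app A)); first exact: cvg_fst.
    exact: tensor_app_continuous.
  by apply: cvgZ; [exact: cvg_snd|exact: cvg_fst].
have norm1 : `|const_mx 1 : 'rV[R]_n.+1| = 1.
  apply: le_anti; apply/andP; split.
    by apply: norm_rV_le => // i; rewrite mxE normr1.
  by apply: le_trans (coord_le_norm _ 0); rewrite mxE normr1.
have K0 : K !=set0.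
  by exists (const_mx 1, 0); split => //=; rewrite in_itv /= lexx addr_ge0.
have [[y0 t0] /set_mem[/= y1 t01] hmin] :=
  compact_EVT_min K0 cK (continuous_subspaceT cphi).
have phi0 : 0 < phi (y0, t0).
  rewrite lt_neqAle normr_ge0 andbT eq_sym normr_eq0; apply/eqP => /= h.
  apply: ZA; exists y0, t0; split => //.
    by rewrite -normr_eq0 y1 oner_eq0.
  by move: t01; rewrite in_itv /= => /andP[].
exists (Num.min 1 (phi (y0, t0))) => [|y t yn t_ge0].
  by rewrite lt_min ltr01.
have [tC|tC] := lerP t (C + 1).
  apply: le_trans (hmin (y, t) _); first by rewrite ge_min lexx orbT.
  by apply/mem_set; split => //=; rewrite in_itv /= t_ge0.
apply: (@le_trans _ _ 1); first by rewrite ge_min lexx.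
have := lerB_normD (t *: y) (tensor_app A y).
rewrite [t *: y + _]addrC normrZ yn mulr1 (ger0_norm t_ge0).
have := hC y; rewrite yn expr1n mulr1; lra.
Qed.

Definition system (R : realType) m n (Lam : tensor_tuple R m n) (x : 'rV[R]_n) :=
  \sum_(k < m.-1) tensor_app (Lam k) x.

Lemma system_continuous (R : realType) m n (Lam : tensor_tuple R m n) :
  continuous (system Lam).
Proof.
apply: continuous_big => [|k _]; first exact: add_continuous.
exact: tensor_app_continuous.
Qed.

Lemma lower_order_bound (R : realType) m n (Lam : tensor_tuple R m n)
    (k : 'I_m.-1) : (0 < k)%N ->
  exists2 C, 0 <= C & forall x : 'rV[R]_n, 1 <= `|x| ->
    `|tensor_app (Lam k) x| <= C * `|x| ^+ (m - 2).
Proof.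
move=> k0; have [C C0 hC] := tensor_app_bound (Lam k); exists C => // x x1.
apply: le_trans (hC x) _; rewrite ler_wpM2l // ler_weXn2l //.
by have := ltn_ord k; lia.
Qed.

(** For [x] of norm at least 1, the leading term plus [t *: x] has norm at least [d] times the power
    [m - 1] of the norm of [x], while the equation bounds it by [M] times the power [m - 2]. *)
Lemma homotopy_zeros_bounded (R : realType) m n (hm : (2 <= m)%N)
    (Lam : tensor_tuple R m n.+1) (b : 'rV[R]_n.+1) :
  Zplus_tensor (leading_tensor hm Lam) ->
  exists2 B, 0 < B & forall (x : 'rV[R]_n.+1) t, 0 <= t ->
    system Lam x - b + t *: x = 0 -> `|x| <= B.
Proof.
move=> /Zplus_lower_bound[d d0 hd].
pose k0 := Ordinal (leading_subproof hm).
(* At [k0] the requirement is vacuous and the value 0 is a placeholder. *)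
have /choice[C hC] : forall k : 'I_m.-1, exists c, k != k0 -> 0 <= c /\
    forall x : 'rV[R]_n.+1, 1 <= `|x| ->
    `|tensor_app (Lam k) x| <= c * `|x| ^+ (m - 2).
  move=> k; have [-> |kk0] := eqVneq k k0; first by exists 0.
  have [|c c0 hc] := @lower_order_bound R m n.+1 Lam k; last by exists c.
  by rewrite lt0n; apply: contra kk0 => /eqP k00; apply/eqP/val_inj.
pose M := \sum_(k | k != k0) C k + `|b|.
have M0 : 0 <= M by rewrite addr_ge0 // sumr_ge0 // => k /hC[].
exists (1 + M / d) => [|x t t0 hx].
  by rewrite ltr_pwDl // divr_ge0 // ltW.
have [x1|x1] := ltP `|x| 1.
  by apply: le_trans (ltW x1) _; rewrite lerDl divr_ge0 // ltW.
have x0 : 0 < `|x| by apply: lt_le_trans x1.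
apply: (@le_trans _ _ (M / d)); last by rewrite lerDr.
rewrite ler_pdivlMr // -(ler_pM2r (exprn_gt0 (m - 2) x0)).
have sysE : system Lam x = tensor_app (leading_tensor hm Lam) x +
    \sum_(k | k != k0) tensor_app (Lam k) x by rewrite /system (bigD1 k0).
have up : `|tensor_app (leading_tensor hm Lam) x + t *: x| <= M * `|x| ^+ (m - 2).
  have -> : tensor_app (leading_tensor hm Lam) x + t *: x =
      b - \sum_(k | k != k0) tensor_app (Lam k) x.
    apply: subr0_eq; apply: eq_trans hx.
    by rewrite sysE opprB addrACA -[RHS]addrA [- b + _]addrC.
  apply: le_trans (ler_normB _ _) _; rewrite /M mulrDl addrC lerD //.
    rewrite mulr_suml; apply: le_trans (ler_norm_sum _ _ _) _.
    by apply: ler_sum => k /hC[_]; apply.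
  by rewrite ler_peMr // exprn_ege1.
apply: le_trans up.
pose y := `|x|^-1 *: x.
have yn : `|y| = 1 by rewrite normrZ normfV normr_id mulVf ?gt_eqF.
have xy : x = `|x| *: y by rewrite scalerA mulfV ?gt_eqF // scale1r.
have tx : 0 <= t * `|x| / `|x| ^+ (m - 1).
  by rewrite divr_ge0 ?exprn_ge0 // mulr_ge0.
(* By homogeneity the expression reduces to the unit vector [y] with a rescaled but still
   nonnegative [t], to which [hd] applies. *)
have -> : tensor_app (leading_tensor hm Lam) x + t *: x = `|x| ^+ (m - 1) *:
    (tensor_app (leading_tensor hm Lam) y + (t * `|x| / `|x| ^+ (m - 1)) *: y).
  rewrite scalerDr -tensor_app_scale -xy scalerA mulrC divfK.
    by rewrite -scalerA -xy.
  by rewrite expf_neq0 // gt_eqF.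
have xm : `|x| ^+ (m - 1) = `|x| * `|x| ^+ (m - 2).
  by rewrite -exprS; congr (_ ^+ _); lia.
rewrite normrZ normrX normr_id [X in _ <= X * _]xm mulrAC.
by rewrite ler_wpM2l ?mulr_ge0 ?exprn_ge0 //; exact: hd.
Qed.

Theorem theorem3p4 (R : realType) (m n : nat) (hm : (2 <= m)%N)
    (hn : (1 <= n)%N) (Lam : tensor_tuple R m n)
    (hZ : Zplus_tensor (leading_tensor hm Lam)) :
  forall b : 'rV[R]_n, SOL Lam b !=set0 /\ compact (SOL Lam b).
Proof.
case: n hn Lam hZ => // n _ Lam hZ b.
have [B B0 hB] := homotopy_zeros_bounded b hZ.
have csys : continuous (system Lam) by exact: system_continuous.
split.
  (* The radius [B + 1] lies strictly beyond the bound [B], so no forbidden relation occurs on that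
     sphere. *)
  have [|||x] := @zero_of_outward R n (fun x => system Lam x - b) (B + 1).
  - by rewrite addr_gt0.
  - by apply: continuous_add; [exact: csys|exact: cst_continuous].
  - move=> x t xB t0; apply/eqP => h.
    have := hB x t (ltW t0) h; rewrite xB; lra.
  by move=> /subr0_eq h; exists x.
apply: bounded_closed_compact.
  exists B; split => [|M BM x xS]; first exact: num_real.
  apply: le_trans (hB x 0 (lexx _) _) (ltW BM).
  by rewrite scale0r addr0 /system xS subrr.
have -> : SOL Lam b = system Lam @^-1` [set b] by [].
apply: preimage_closed; first by move=> x _; exact: csys.
exact/accessible_closed_set1/hausdorff_accessible/norm_hausdorff.
Qed.
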